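(* Let $K$ be an odd prime and $d\ge 1$ an integer. There exists a constant $C(d,K)>0$ depending only on $d$ and $K$ such that the following holds for every integer $n\ge 1$. Let $S$ be a maximal (with respect to inclusion) subset of $\{0,1,\ldots,K-1\}^n$ such that for all $\alpha,\beta\in S$: (i) (support sizes are equal) $|\mathrm{supp}(\alpha)|=|\mathrm{supp}(\beta)|$; (ii) (degrees are equal) $|\alpha|=|\beta|$; (iii) (individual degree symmetry) there is a bijection $\pi:\mathrm{supp}(\alpha)\to\mathrm{supp}(\beta)$ such that for all $j\in\mathrm{supp}(\alpha)$, $\alpha_j=\beta_{\pi(j)}$ or $\alpha_j=K-\beta_{\pi(j)}$. Then for every $n$-variate analytic polynomial $f$ of degree at most $d$ and individual degree at most $K-1$, the $S$-part $f_S:=\sum_{\alpha\in S}\widehat f(\alpha)z^\alpha$ of $f$ satisfies $$\|f_S\|_{\Omega_K^n}\le C(d,K)\,\|f\|_{\Omega_K^n}.$$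
   Context: $\Omega_K=\{1,\omega_K,\dots,\omega_K^{K-1}\}$ with $\omega_K=e^{2\pi i/K}$. An analytic polynomial of (total) degree at most $d$ and individual degree at most $K-1$ is a function $f(z)=\sum_{\alpha\in\{0,1,\dots,K-1\}^n,\ |\alpha|\le d}\widehat f(\alpha)z^\alpha$ with $\widehat f(\alpha)\in\mathbf{C}$ (and $\widehat f(\alpha)=0$ for $|\alpha|>d$), where $|\alpha|=\sum_j\alpha_j$ and $z^\alpha=\prod_j z_j^{\alpha_j}$. For a multi-index $\alpha$, $\mathrm{supp}(\alpha)=\{j:\alpha_j\ne 0\}$ and $|\mathrm{supp}(\alpha)|$ is its cardinality. For a set $X$, $\|f\|_X:=\sup_{x\in X}|f(x)|$. *)

(* Defs.v *)
From HB Require Import structures.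
From mathcomp Require Import all_boot all_order all_algebra.
From mathcomp Require Import classical_sets reals trigo.
From mathcomp Require Export complex.

Set Implicit Arguments.
Unset Strict Implicit.
Unset Printing Implicit Defensive.

Import Order.TTheory GRing.Theory Num.Theory.

Local Open Scope classical_set_scope.
Local Open Scope ring_scope.
Local Open Scope complex_scope.

(* e^(2 pi i / K) *)
Definition omega (R : realType) (K : nat) : R[i] :=
  cos (2 * pi / K%:R) +i* sin (2 * pi / K%:R).
Arguments omega : clear implicits.

Definition Omega (R : realType) (K : nat) : set R[i] :=
  [set omega R K ^+ k | k in [set k : nat | (k < K)%N]].
Arguments Omega : clear implicits.

Definition Omega_pow (R : realType) (K n : nat) : set ('I_n -> R[i]) :=
  [set z | forall j, Omega R K (z j)].
Arguments Omega_pow : clear implicits.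

(* [sup] is the least upper bound only for nonempty sets that are bounded
   above (it is 0 otherwise); the finite nonempty set [Omega_pow R K n] with
   [0 < K] is such a case for every [f]. *)
Definition supnorm (R : realType) (T : Type) (X : set T) (f : T -> R[i]) : R :=
  sup [set ComplexField.Normc.normc (f x) | x in X].

(* {0, ..., K-1}^n *)
Notation multi_index n K := {ffun 'I_n -> 'I_K}.

Definition mdegree (n K : nat) (a : multi_index n K) : nat :=
  (\sum_(j < n) a j)%N.

Definition msupp (n K : nat) (a : multi_index n K) : {set 'I_n} :=
  [set j | (a j != 0 :> nat)%N].

Definition monomial (R : realType) (n K : nat) (a : multi_index n K)
    (z : 'I_n -> R[i]) : R[i] :=
  \prod_(j < n) z j ^+ a j.

(* A polynomial of individual degree at most K-1 is given by its family of
   coefficients [c]. *)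
Definition apoly (R : realType) (n K : nat) (c : multi_index n K -> R[i])
    (z : 'I_n -> R[i]) : R[i] :=
  \sum_(a : multi_index n K) c a * monomial a z.

Definition degree_at_most (R : realType) (n K d : nat)
    (c : multi_index n K -> R[i]) : Prop :=
  forall a : multi_index n K, (d < mdegree a)%N -> c a = 0.

Definition part (R : realType) (n K : nat) (S : {set multi_index n K})
    (c : multi_index n K -> R[i]) (z : 'I_n -> R[i]) : R[i] :=
  \sum_(a in S) c a * monomial a z.

(* The subtraction is the one of [nat]; it does not truncate as [b _ < K]. *)
Definition degree_symmetric (n K : nat) (a b : multi_index n K) : Prop :=
  exists pi : {j | j \in msupp a} -> {j | j \in msupp b},
    bijective pi /\
    forall j, (a (val j) = b (val (pi j)) :> nat) \/
              (a (val j) = K - b (val (pi j)) :> nat)%N.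

Definition admissible (n K : nat) (S : {set multi_index n K}) : Prop :=
  forall a b : multi_index n K, a \in S -> b \in S ->
    [/\ #|msupp a| = #|msupp b|,
        mdegree a = mdegree b &
        degree_symmetric a b].

Definition maximal_admissible (n K : nat) (S : {set multi_index n K}) : Prop :=
  admissible S /\
  forall T : {set multi_index n K}, admissible T -> S \subset T -> T = S.

(* Main.v *)
(* For t in [0, 1] draw the y_j independently, y_j = omega with probability t
   and y_j = 1 otherwise.  The average of f (z y) is bounded by the norm of f,
   and it multiplies the coefficient of z^a by
     prod_j (1 + t (omega^(a_j) - 1)) = prod_(k != 0) (1 + t (omega^k - 1))^(m_k),
   where m_k counts the coordinates j with a_j = k.  As polynomials in t these
   have distinct roots, of multiplicity m_k, so different count vectors m are
   separated by some t.  Interpolating over the finitely many m with entries at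
   most d, a number independent of n, every function of m is a multiplier
   bounded uniformly in n.  By maximality S is invariant under permutations of
   coordinates, so membership in S is such a function of m. *)
Require Import Defs.
From mathcomp Require Import all_boot all_order all_algebra.
From mathcomp Require Import perm.
From mathcomp Require Import classical_sets reals trigo.

Set Implicit Arguments.
Unset Strict Implicit.
Unset Printing Implicit Defensive.

Import Order.TTheory GRing.Theory Num.Theory.

Local Open Scope ring_scope.

(** * Roots of unity and the points of the grid *)

Section RootsOfUnity.
Variables (R : realType) (K : nat).
Local Notation w := (omega R K).
Local Notation OK := (Omega_pow R K).

Lemma omegaX m :
  w ^+ m = Complex (cos (m%:R * (2 * pi / K%:R))) (sin (m%:R * (2 * pi / K%:R))).
Proof.
elim: m => [|m IHm]; first by rewrite mul0r cos0 sin0.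
rewrite exprSr IHm -[in RHS]natr1 [in RHS]mulrDl mul1r cosD sinD.
by apply/eqP; rewrite eq_complex /= eqxx addrC eqxx.
Qed.

Lemma omega_expK : (0 < K)%N -> w ^+ K = 1.
Proof.
move=> K0; rewrite omegaX mulrC divfK ?pnatr_eq0 -?lt0n // mulrC mulr_natr.
by rewrite -[_ *+ _]add0r cosD2pi sinD2pi cos0 sin0.
Qed.

Lemma omega_neq1 : (2 < K)%N -> w != 1.
Proof.
move=> K2; have K0 : 0 < K%:R :> R by rewrite ltr0n (ltn_trans _ K2).
rewrite eq_complex /= negb_and; apply/orP; right; rewrite gt_eqF//.
apply: sin_gt0_pi; rewrite divr_gt0 ?mulr_gt0 ?pi_gt0//=.
by rewrite ltr_pdivrMr// mulrC ltr_pM2l ?pi_gt0// ltr_nat.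
Qed.

(** The order of [w] divides the prime [K], and it is not 1 because [sin (2 * pi / K) > 0] when
    [K > 2]. *)
Lemma omega_prim : prime K -> odd K -> K.-primitive_root w.
Proof.
move=> Kp Ko; have K0 := prime_gt0 Kp.
have [m m_prim mK] := prim_order_exists K0 (omega_expK K0).
have [_ K_div] := primeP Kp.
have /orP[/eqP m1|/eqP m_eq] := K_div m mK; last by rewrite m_eq in m_prim.
have K2 : (2 < K)%N by rewrite odd_gt2// prime_gt1.
have := omega_neq1 K2; have := prim_expr_order m_prim.
by rewrite m1 expr1 => ->; rewrite eqxx.
Qed.

Lemma Omega_pow1 n : (0 < K)%N -> OK n (fun=> 1).
Proof. by move=> K0 j; exists 0%N; rewrite ?expr0. Qed.

Lemma Omega_powM n z (y : 'I_n -> nat) : (0 < K)%N -> OK n z ->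
  OK n (fun j => z j * w ^+ y j).
Proof.
move=> K0 zO j; have [k _ <-] := zO j.
exists ((k + y j) %% K)%N; first by rewrite /= ltn_mod.
by rewrite -exprD -[in RHS](expr_mod _ (omega_expK K0)).
Qed.

Lemma norm_monomial n z (a : multi_index n K) : (0 < K)%N -> OK n z ->
  `|monomial a z| = 1.
Proof.
move=> K0 zO; rewrite normr_prod big1 // => j _.
have [k _ <-] := zO j; rewrite !normrX (_ : `|w| = 1) ?expr1n//.
by apply/eqP; rewrite -(pexpr_eq1 K0)// -normrX omega_expK ?normr1.
Qed.

Lemma monomialM n (a : multi_index n K) (z y : 'I_n -> R[i]) :
  monomial a (fun j => z j * y j) = monomial a z * monomial a y.
Proof. by rewrite -big_split; apply: eq_bigr => j _; rewrite exprMn. Qed.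

End RootsOfUnity.

(** * The supremum norm on the finite grid *)

Section SupNorm.
Variables (R : realType) (K n : nat).
Hypothesis K_gt0 : (0 < K)%N.
Implicit Type (c : multi_index n K -> R[i]).

Lemma norm_apoly_le_supnorm c z : Omega_pow R K n z ->
  `|apoly c z| <= (supnorm (Omega_pow R K n) (apoly c))%:C%C.
Proof.
move=> zO; rewrite -[`|_|]/((_ : R)%:C%C) lecR.
apply: ub_le_sup; last by exists z.
(* Monomials have modulus 1 on the grid, so this sum bounds the values; [sup] is then a genuine
   upper bound, not its default 0. *)
exists (complex.Re (\sum_a `|c a|)) => _ [x xO <-].
rewrite -lecR RRe_real ?ger0_real ?sumr_ge0//.
rewrite -[(_)%:C%C]/(`|_ : R[i]|); apply: le_trans (ler_norm_sum _ _ _) _.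
by apply: ler_sum => a _; rewrite normrM norm_monomial ?mulr1.
Qed.

Lemma supnorm_le (f : ('I_n -> R[i]) -> R[i]) (B : R) :
  (forall z, Omega_pow R K n z -> `|f z| <= B%:C%C) ->
  supnorm (Omega_pow R K n) f <= B.
Proof.
move=> fB; apply: ge_sup; last by move=> _ [z zO <-]; rewrite -lecR; exact: fB.
by exists (ComplexField.Normc.normc (f (fun=> 1))), (fun=> 1) => //; exact: Omega_pow1.
Qed.

End SupNorm.

(* The expectation of [f (z * y)] over independent coordinates [y j], equal to
   [omega] with probability [t] and to [1] otherwise. *)
Lemma norm_random_twist (R : realType) (K n : nat) (c : multi_index n K -> R[i])
    (B : R[i]) (t : R) : (0 < K)%N -> 0 <= t <= 1 ->
  (forall z, Omega_pow R K n z -> `|apoly c z| <= B) ->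
  forall z, Omega_pow R K n z ->
  `|apoly (fun a => (\prod_j (1 + (omega R K ^+ a j - 1) * t%:C%C)) * c a) z| <= B.
Proof.
move=> K0 /andP[t0 t1] cB z zO; set w := omega R K.
pose p (b : bool) : R[i] := if b then t%:C%C else 1 - t%:C%C.
have p_ge0 b : 0 <= p b.
  by case: b; rewrite /p ?ler0c// subr_ge0 -[1]/(1%:C%C) lecR.
pose P (y : {ffun 'I_n -> bool}) := \prod_j p (y j).
have P_ge0 y : 0 <= P y by rewrite prodr_ge0.
have P_sum : \sum_y P y = 1.
  rewrite /P -(bigA_distr_bigA (fun _ => p)) big1// => j _.
  by rewrite big_bool /p /= addrC subrK.
have -> : apoly (fun a => (\prod_j (1 + (w ^+ a j - 1) * t%:C%C)) * c a) z =
    \sum_y P y * apoly c (fun j => z j * w ^+ (y j)).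
  rewrite /apoly; under [RHS]eq_bigr do rewrite mulr_sumr.
  rewrite exchange_big; apply: eq_bigr => a _ /=.
  rewrite -mulrA mulrC.
  (* Independence: the expectation of a monomial is the product of its one-coordinate
     expectations. *)
  have -> : \prod_j (1 + (w ^+ a j - 1) * t%:C%C) =
      \sum_y P y * monomial a (fun j => w ^+ y j).
    under [RHS]eq_bigr do rewrite -big_split/=.
    rewrite -(bigA_distr_bigA (fun j b => p b * (w ^+ b) ^+ a j)).
    apply: eq_bigr => j _; rewrite big_bool /p /= expr1 expr0 expr1n mulr1.
    by rewrite mulrBl mul1r [RHS]addrCA [t%:C%C * _]mulrC.
  rewrite mulr_sumr; apply: eq_bigr => y _.
  by rewrite monomialM mulrCA !mulrA.
apply: le_trans (ler_norm_sum _ _ _) _.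
rewrite -[leRHS]mul1r -P_sum mulr_suml; apply: ler_sum => y _.
rewrite normrM (ger0_norm (P_ge0 y)) ler_wpM2l//; apply: cB.
exact: (Omega_powM (fun j => nat_of_bool (y j))).
Qed.

(** * Count vectors and dimension-free multipliers *)

Section Counts.
Variables (R : realType) (K d : nat).
Local Notation w := (omega R K).
Local Notation exponent := {k : 'I_K | k != 0%N :> nat}.
Local Notation counts := {ffun exponent -> 'I_d.+1}.
Implicit Types (m : counts).

(* Faithful only for [mdegree a <= d]: [inord] returns junk out of range. *)
Definition exponent_counts n (a : multi_index n K) : counts :=
  [ffun k : exponent => inord #|[pred j | a j == val k]|].

Lemma exponent_countsE n (a : multi_index n K) (k : exponent) :
  (mdegree a <= d)%N -> exponent_counts a k = #|[pred j | a j == val k]| :> nat.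
Proof.
move=> a_d; rewrite ffunE inordK// ltnS; apply: leq_trans a_d.
rewrite -sum1_card /mdegree [leqRHS](bigID [pred j | a j == val k])/=.
apply: leq_trans (leq_addr _ _); apply: leq_sum => j /eqP ->.
by rewrite lt0n (valP k).
Qed.

(** Defined for every [m], realised by a multi-index or not, so that interpolation can run over a
    finite type fixed by [d] and [K]. *)
Definition count_poly m : {poly R[i]} :=
  \prod_(k : exponent) (1 + (w ^+ val k - 1) *: 'X) ^+ m k.

(** Group the coordinates by the value of [a j]; those with [a j = 0] contribute the factor 1. *)
Lemma horner_count_poly n (a : multi_index n K) t :
  (mdegree a <= d)%N ->
  (count_poly (exponent_counts a)).[t] = \prod_j (1 + (w ^+ a j - 1) * t).
Proof.
move=> a_d; pose F k : R[i] := 1 + (w ^+ k - 1) * t.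
transitivity (\prod_j \prod_(k : exponent) if a j == val k then F (val k) else 1).
  rewrite exchange_big /count_poly horner_prod; apply: eq_bigr => k _ /=.
  rewrite exponent_countsE// -big_mkcond prodr_const horner_exp /F.
  by rewrite !hornerE.
apply: eq_bigr => j _; have [aj0|aj0] := eqVneq (a j : nat) 0%N.
  rewrite aj0 expr0 subrr mul0r addr0 big1// => k _.
  by rewrite -val_eqE /= aj0 eq_sym (negPf (valP k)).
rewrite (bigD1 (exist _ (a j) aj0))//= eqxx big1 ?mulr1// => k.
by rewrite -val_eqE eq_sym /= => /negPf ->.
Qed.

Hypothesis w_prim : K.-primitive_root w.

Lemma omega_expB1_neq0 (k : 'I_K) : k != 0%N :> nat -> w ^+ k - 1 != 0.
Proof.
move=> k0; rewrite subr_eq0 -(prim_order_dvd w_prim) gtnNdvd//.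
by rewrite lt0n.
Qed.

(** Only the [k]-th factor vanishes at this point, since the powers [w ^+ l] with [l < K] are
    distinct. Root multiplicities thus recover [m]. *)
Lemma mup_count_poly m (k : exponent) :
  mup (- (w ^+ val k - 1)^-1) (count_poly m) = m k.
Proof.
rewrite /count_poly (bigD1 k)//=; set r := - _.
have wk := omega_expB1_neq0 (valP k).
rewrite mupMl; last first.
  rewrite /root horner_prod; apply/prodf_neq0 => l lk.
  rewrite horner_exp expf_neq0// !hornerE /r mulrN subr_eq0.
  apply: contra lk => /eqP e; apply/eqP/val_inj/val_inj/eqP.
  have /eqP : w ^+ val l = w ^+ val k.
    by apply: (addIr (-1)); rewrite -[LHS](divfK wk) -e mul1r.
  by rewrite (eq_prim_root_expr w_prim) !modn_small.
have -> : 1 + (w ^+ val k - 1) *: 'X = (w ^+ val k - 1)%:P * ('X - r%:P).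
  by rewrite mulrBr -polyCM /r mulrN divff// polyCN opprK addrC mul_polyC.
rewrite exprMn mupMr; last first.
  by rewrite /root -polyC_exp hornerC expf_neq0.
by rewrite mup_XsubCX eqxx.
Qed.

Lemma count_poly_inj : injective count_poly.
Proof.
move=> m m' mm'; apply/ffunP => k; apply/val_inj.
by rewrite /= -!mup_count_poly mm'.
Qed.

(** The difference [p] is a nonzero polynomial, so it cannot vanish at all of the [size p] distinct
    points [1 / (i + 1)] of [[0, 1]]. *)
Lemma separating_time m m' : m != m' ->
  exists2 t : R, 0 <= t <= 1 & (count_poly m).[t%:C%C] != (count_poly m').[t%:C%C].
Proof.
move=> mm'; pose p := count_poly m - count_poly m'.
have p0 : p != 0 by rewrite subr_eq0 (inj_eq count_poly_inj).
pose s : seq R := [seq i.+1%:R^-1 | i <- iota 0 (size p)].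
have s_uniq : uniq [seq t%:C%C | t <- s].
  rewrite map_inj_uniq ?map_inj_uniq ?iota_uniq//.
    by move=> i j /invr_inj /eqP; rewrite eqr_nat => /eqP[].
  exact: complexI.
have /allPn[_ /mapP[t ts ->] pt] : ~~ all (root p) [seq t%:C%C | t <- s].
  apply/negP => rs; have := max_poly_roots p0 rs s_uniq.
  by rewrite !size_map size_iota ltnn.
exists t; last by move: pt; rewrite /root /p hornerD hornerN subr_eq0.
case/mapP: ts => i _ ->; rewrite invr_ge0 ler0n /= invf_le1 ?ltr0n//.
by rewrite ler1n.
Qed.

(* [C] is chosen before [n]: this makes the final constant dimension free. *)
Definition bounded_multiplier (l : counts -> R[i]) : Prop :=
  exists2 C : R[i], 0 <= C & forall n (c : multi_index n K -> R[i]) B,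
    degree_at_most d c -> (forall z, Omega_pow R K n z -> `|apoly c z| <= B) ->
    forall z, Omega_pow R K n z ->
      `|apoly (fun a => l (exponent_counts a) * c a) z| <= C * B.

Lemma bounded_multiplier_eq l l' : l =1 l' ->
  bounded_multiplier l -> bounded_multiplier l'.
Proof.
move=> ll' [C C0 lC]; exists C => // n c B cd cB z zO.
have := lC n c B cd cB z zO; congr (`|_| <= _).
by apply: eq_bigr => a _; rewrite ll'.
Qed.

Lemma bounded_multiplier_const x : bounded_multiplier (fun=> x).
Proof.
exists `|x| => // n c B cd cB z zO.
have -> : apoly (fun a => x * c a) z = x * apoly c z.
  by rewrite mulr_sumr; apply: eq_bigr => a _; rewrite mulrA.
by rewrite normrM ler_wpM2l ?cB.
Qed.

Lemma bounded_multiplierD l l' : bounded_multiplier l -> bounded_multiplier l' ->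
  bounded_multiplier (fun m => l m + l' m).
Proof.
move=> [C C0 lC] [C' C'0 lC']; exists (C + C'); first exact: addr_ge0.
move=> n c B cd cB z zO; rewrite mulrDl.
apply: le_trans (lerD (lC _ _ _ cd cB _ zO) (lC' _ _ _ cd cB _ zO)).
apply: le_trans (ler_normD _ _); rewrite -big_split/=.
rewrite le_eqVlt; apply/orP; left; apply/eqP; congr `|_|.
by apply: eq_bigr => a _; rewrite !mulrDl.
Qed.

(** Apply [l'] first, then [l]: multipliers preserve the degree bound, and the constants
    multiply. *)
Lemma bounded_multiplierM l l' : bounded_multiplier l -> bounded_multiplier l' ->
  bounded_multiplier (fun m => l m * l' m).
Proof.
move=> [C C0 lC] [C' C'0 lC']; exists (C * C'); first exact: mulr_ge0.
move=> n c B cd cB z zO; rewrite -mulrA.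
have l'd : degree_at_most d (fun a => l' (exponent_counts a) * c a).
  by move=> a /cd ->; rewrite mulr0.
have := lC _ _ _ l'd (lC' _ _ _ cd cB) z zO; congr (`|_| <= _).
by apply: eq_bigr => a _; rewrite !mulrA.
Qed.

Lemma bounded_multiplier_prod (I : Type) (s : seq I) (P : pred I)
    (l : I -> counts -> R[i]) :
  (forall i, P i -> bounded_multiplier (l i)) ->
  bounded_multiplier (fun m => \prod_(i <- s | P i) l i m).
Proof.
move=> lb; elim: s => [|i s IHs].
  apply: (bounded_multiplier_eq (l := fun=> 1)) (bounded_multiplier_const 1) => m.
  by rewrite big_nil.
have [Pi|Pi] := boolP (P i); last first.
  by apply: bounded_multiplier_eq IHs => m; rewrite big_cons (negPf Pi).
apply: bounded_multiplier_eq (bounded_multiplierM (lb i Pi) IHs) => m.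
by rewrite big_cons Pi.
Qed.

Lemma bounded_multiplier_sum (I : Type) (s : seq I) (P : pred I)
    (l : I -> counts -> R[i]) :
  (forall i, P i -> bounded_multiplier (l i)) ->
  bounded_multiplier (fun m => \sum_(i <- s | P i) l i m).
Proof.
move=> lb; elim: s => [|i s IHs].
  apply: (bounded_multiplier_eq (l := fun=> 0)) (bounded_multiplier_const 0) => m.
  by rewrite big_nil.
have [Pi|Pi] := boolP (P i); last first.
  by apply: bounded_multiplier_eq IHs => m; rewrite big_cons (negPf Pi).
apply: bounded_multiplier_eq (bounded_multiplierD (lb i Pi) IHs) => m.
by rewrite big_cons Pi.
Qed.

Lemma bounded_multiplier_count_poly (t : R) : 0 <= t <= 1 ->
  bounded_multiplier (fun m => (count_poly m).[t%:C%C]).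
Proof.
move=> t01; exists 1 => // n c B cd cB z zO; rewrite mul1r.
have := norm_random_twist (prim_order_gt0 w_prim) t01 cB zO; congr (`|_| <= _).
apply: eq_bigr => a _; congr (_ * _).
(* Above degree [d] the counts may be junk, but the coefficient vanishes. *)
have [a_d|/cd->] := leqP (mdegree a) d; last by rewrite !mulr0.
by rewrite horner_count_poly.
Qed.

Lemma bounded_multiplier_separate m m' : m != m' ->
  exists2 l, bounded_multiplier l & l m = 1 /\ l m' = 0.
Proof.
move=> mm'; have [t t01] := separating_time mm'.
set q := fun m => (count_poly m).[t%:C%C]; rewrite -/(q m) -/(q m') => qm.
exists (fun m0 => (q m - q m')^-1 * (q m0 + - q m')).
  apply: bounded_multiplierM (bounded_multiplier_const _) _.
  apply: bounded_multiplierD (bounded_multiplier_const _).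
  exact: bounded_multiplier_count_poly.
by rewrite subrr mulr0 mulVf ?subr_eq0.
Qed.

(* Lagrange interpolation over the finitely many count vectors. *)
Lemma bounded_multiplier_all l : bounded_multiplier l.
Proof.
suff ind m : bounded_multiplier (fun m' => (m' == m)%:R).
  have := @bounded_multiplier_sum _ (index_enum counts) xpredT
    (fun m m' => l m * (m' == m)%:R)
    (fun m _ => bounded_multiplierM (bounded_multiplier_const (l m)) (ind m)).
  apply: bounded_multiplier_eq => m.
  rewrite (bigD1 m)//= eqxx mulr1 big1 ?addr0// => m' /negPf m'm.
  by rewrite eq_sym m'm mulr0.
have sep (m' : counts) : exists2 l', bounded_multiplier l' &
    (m' != m -> l' m = 1 /\ l' m' = 0).
  have [->|] := eqVneq m' m.
    by exists (fun=> 1); first exact: bounded_multiplier_const.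
  by rewrite eq_sym => /bounded_multiplier_separate[l' l'b l'm]; exists l'.
have [L Lb Lm] := fin_all_exists2 sep.
(* The product of the [L m'] over [m' != m] is the indicator of [m]: it is 1 at [m], and the factor
   [L m'] kills it at [m']. *)
have := @bounded_multiplier_prod _ (index_enum counts) (predC1 m) L (fun m' _ => Lb m').
apply: bounded_multiplier_eq => m'; have [->|m'm] := eqVneq m' m.
  by rewrite big1// => m0 /Lm[].
by rewrite (bigD1 m')//= (Lm m' m'm).2 mul0r.
Qed.

End Counts.

(** * Permutation invariance of maximal admissible sets *)

Section DegreeSymmetric.
Variables (n K : nat).
Implicit Types a b g : multi_index n K.

Lemma degree_symmetric_sym a b : degree_symmetric a b -> degree_symmetric b a.
Proof.
move=> [f [[g fK gK] fab]]; exists g; split; first by exists f.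
move=> j; have := fab (g j); rewrite gK => -[->|->]; [by left|right].
by rewrite subKn// ltnW.
Qed.

Lemma degree_symmetric_trans a b g :
  degree_symmetric a b -> degree_symmetric b g -> degree_symmetric a g.
Proof.
move=> [f [fb fab]] [f' [f'b fbg]]; exists (f' \o f); split; first exact: bij_comp.
move=> j /=; case: (fab j) => ->; case: (fbg (f j)) => ->; [by left|by right|by right|].
by left; rewrite subKn// ltnW.
Qed.

Lemma degree_symmetric_perm a b (s : {perm 'I_n}) :
  (forall j, a j = b (s j)) -> degree_symmetric a b.
Proof.
move=> ab.
have sP (j : {j | j \in msupp a}) : s (val j) \in msupp b.
  by move: (valP j); rewrite !inE ab.
have tP (j : {j | j \in msupp b}) : (s^-1)%g (val j) \in msupp a.
  by move: (valP j); rewrite !inE ab permKV.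
exists (fun j => exist (fun i => i \in msupp b) _ (sP j));
  split; last by move=> j; left; rewrite /= ab.
exists (fun j => exist (fun i => i \in msupp a) _ (tP j)) => j; apply/val_inj => /=.
  by rewrite permK.
by rewrite permKV.
Qed.

(** All three conditions pass from [b] to its rearrangement [a], so [a |: S] is still admissible and
    maximality forces it to equal [S]. *)
Lemma maximal_admissible_perm (S : {set multi_index n K}) a b (s : {perm 'I_n}) :
  maximal_admissible S -> (forall j, a j = b (s j)) -> b \in S -> a \in S.
Proof.
move=> [Sadm Smax] ab bS; suff <- : a |: S = S by rewrite setU11.
apply: Smax; last exact: subsetU1.
have ab_supp : #|msupp a| = #|msupp b|.
  have -> : msupp a = s @^-1: msupp b by apply/setP => j; rewrite !inE ab.
  by rewrite card_preimset//; exact: perm_inj.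
have ab_deg : mdegree a = mdegree b.
  rewrite /mdegree [RHS](reindex_inj (@perm_inj _ s)).
  by apply: eq_bigr => j _; rewrite ab.
have ab_sym := degree_symmetric_perm ab.
have aS g : g \in S ->
    [/\ #|msupp a| = #|msupp g|, mdegree a = mdegree g & degree_symmetric a g].
  move=> /(Sadm _ _ bS)[bg_supp bg_deg bg_sym].
  by rewrite ab_supp ab_deg; split=> //; exact: degree_symmetric_trans ab_sym bg_sym.
move=> g h /setU1P[->|gS] /setU1P[->|hS]; last exact: Sadm.
- by split=> //; exact: degree_symmetric_trans ab_sym (degree_symmetric_sym ab_sym).
- exact: aS.
- by have [-> -> /degree_symmetric_sym] := aS g gS.
Qed.

Lemma exponent_counts_perm d a b : (mdegree a <= d)%N -> (mdegree b <= d)%N ->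
  exponent_counts d a = exponent_counts d b ->
  exists s : {perm 'I_n}, forall j, a j = b (s j).
Proof.
move=> a_d b_d ab.
have card_ab (k : 'I_K) : k != 0%N :> nat ->
    #|[pred j | a j == k]| = #|[pred j | b j == k]|.
  move=> k0; pose l : {k : 'I_K | k != 0%N :> nat} := exist _ k k0.
  by rewrite -(exponent_countsE l a_d) ab (exponent_countsE l b_d).
have card_ab0 (k : 'I_K) : #|[pred j | a j == k]| = #|[pred j | b j == k]|.
  have [k0|/card_ab//] := eqVneq (k : nat) 0%N.
  (* Count vectors omit the value 0; its number of occurrences is [n] minus all the others. *)
  have split0 (c : multi_index n K) : n = (#|[pred j | c j == k]| +
      \sum_(l | l != k) #|[pred j | c j == l]|)%N.
    rewrite -[LHS]card_ord -sum1_card (partition_big c xpredT)// (bigD1 k)//=.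
    by rewrite sum1_card; congr addn; apply: eq_bigr => l _; rewrite sum1_card.
  apply: (@addIn (\sum_(l | l != k) #|[pred j | b j == l]|)).
  rewrite -(split0 b) [RHS](split0 a); congr addn.
  by apply: eq_bigr => l lk; rewrite card_ab// -k0.
have /tuple_permP[s /val_inj abs] : perm_eq [tuple a j | j < n] [tuple b j | j < n].
  apply/allP => k _; rewrite /= !count_map; apply/eqP.
  by have := card_ab0 k; rewrite !cardE !size_filter.
by exists s => j; rewrite -(tnth_mktuple a) abs !tnth_mktuple.
Qed.

End DegreeSymmetric.

Theorem theorem2 (R : realType) (K d : nat) (K_prime : prime K)
    (K_odd : odd K) (d_ge1 : (1 <= d)%N) :
  exists C : R, 0 < C /\
    forall (n : nat), (1 <= n)%N ->
    forall S : {set multi_index n K}, maximal_admissible S ->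
    forall c : multi_index n K -> R[i], degree_at_most d c ->
      supnorm (Omega_pow R K n) (part S c)
        <= C * supnorm (Omega_pow R K n) (apoly c).
Proof.
have w_prim := omega_prim R K_prime K_odd.
have K0 := prime_gt0 K_prime.
(* One indicator multiplier for each set [T] of count vectors. There are finitely many [T], and [n]
   is not yet fixed, so the sum of their constants serves all dimensions; the added 1 makes it
   positive. *)
have bdd T := bounded_multiplier_all w_prim
  (fun m : {ffun {k : 'I_K | k != 0%N :> nat} -> 'I_d.+1} =>
     (m \in (T : {set _}))%:R).
have [C C0 CT] := fin_all_exists2 bdd.
have C_le T : C T <= 1 + \sum_T C T.
  by rewrite (bigD1 T)//= addrCA ler_wpDr// addr_ge0// sumr_ge0.
have C_real : (complex.Re (1 + \sum_T C T))%:C%C = 1 + \sum_T C T.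
  by rewrite RRe_real// ger0_real// addr_ge0 ?sumr_ge0.
exists (complex.Re (1 + \sum_T C T)); split.
  by rewrite -ltcR C_real ltr_wpDr// sumr_ge0.
move=> n _ S Smax c cd; apply: supnorm_le => // z zO.
set B := supnorm _ _; rewrite rmorphM/= C_real.
have cB x : Omega_pow R K n x -> `|apoly c x| <= B%:C%C.
  exact: norm_apoly_le_supnorm.
have B0 : 0 <= B%:C%C by apply: le_trans (cB z zO).
(* Up to degree [d], equal counts mean equality up to a permutation of coordinates, so invariance of
   [S] makes [T] detect membership in [S]. *)
pose T := [set exponent_counts d a | a in S & (mdegree a <= d)%N].
apply: le_trans (ler_wpM2r B0 (C_le T)).
have := CT T n c _ cd cB z zO; congr (`|_| <= _).
rewrite /part big_mkcond; apply: eq_bigr => a _.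
have [a_d|/cd->] := leqP (mdegree a) d; last by rewrite !mulr0 mul0r if_same.
suff -> : (exponent_counts d a \in T) = (a \in S).
  by case: ifP => _; rewrite ?mul1r ?mul0r.
apply/imsetP/idP => [[b]|aS]; last by exists a; rewrite ?inE ?aS.
rewrite inE => /andP[bS b_d] /(exponent_counts_perm a_d b_d)[s ab].
exact: maximal_admissible_perm Smax ab bS.
Qed.
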